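(* Let $G$ be a countable group acting faithfully by homeomorphisms on a second countable Hausdorff space $X$, and let $\mu$ be an ergodic invariant random subgroup (IRS) of $G$. (i) If $\mu\neq\delta_{\{id\}}$, then for $\mu$-a.e. subgroup $H$ there exists a non-empty open set $U\subseteq X$ such that $[R_G(U),R_G(U)]\le H$. (ii) Suppose in addition that for any open set $V$ of $X$, $R_G(V)$ has no fixed point in $V$. Then $\mu$-a.e. subgroup $H$ satisfies the following property: if $x\in X$ is not a fixed point of $H$, then there exists an open neighborhood $U$ of $x$ such that $[R_G(U),R_G(U)]\le H$.
   Context: Group actions are right actions. For a countable group $G$, $\mathrm{Sub}(G)$ is the space of subgroups of $G$ with the Chabauty topology, i.e. the topology induced from the product topology on $\{0,1\}^G$. An invariant random subgroup (IRS) of $G$ is a Borel probability measure on $\mathrm{Sub}(G)$ invariant under conjugation by $G$; it is ergodic if it is ergodic for the conjugation action of $G$. $\delta_{\{id\}}$ is the point mass at the trivial subgroup. For $U\subseteq X$, the rigid stabilizer is $R_G(U)=\{g\in G:\ x\cdot g=x \text{ for all } x\in X\setminus U\}$. A point is a fixed point of a subgroup if it is fixed by all of its elements. $[A,A]$ denotes the derived (commutator) subgroup of a group $A$. *)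

(* Defs.v *)
From HB Require Import structures.
From mathcomp Require Import all_boot all_order all_algebra.
From mathcomp Require Import all_classical all_reals all_analysis.

Set Implicit Arguments.
Unset Strict Implicit.
Unset Printing Implicit Defensive.

Local Open Scope classical_set_scope.
Local Open Scope group_scope.

(* The space [Sub(G)] of subgroups: a [set_type] carries the topology induced
   by the ambient space, here the product space {0,1}^G with {0,1} discrete. *)
Definition subgroups (G : groupType) :
    set (prod_topology (fun _ : G => bool)) :=
  [set S | group_closed (S : {pred G})].

Definition subgroupSpace (G : groupType) := set_type (@subgroups G).

HB.instance Definition _ (G : groupType) := Topological.on (subgroupSpace G).

Lemma trivial_subgroup_subproof (G : groupType) :
  (fun g : G => g == 1) \in @subgroups G.
Proof.
rewrite inE; split=> [|x y]; rewrite !unfold_in ?eqxx // => /eqP-> /eqP->.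
by rewrite divg1.
Qed.

Definition trivial_subgroup (G : groupType) : subgroupSpace G :=
  exist (fun S => S \in @subgroups G) _ (trivial_subgroup_subproof G).

(* The library's measurable types are pointed. *)
HB.instance Definition _ (G : groupType) :=
  isPointed.Build (subgroupSpace G) (trivial_subgroup G).

Definition borelSub (G : groupType) :=
  g_sigma_algebraType (@open (subgroupSpace G)).

Definition carrier (G : groupType) (H : subgroupSpace G) : set G :=
  [set g | set_val H g].

Section Subgroups.
Variable G : groupType.

Lemma conj_subgroup_subproof (g : G) (H : subgroupSpace G) :
  (fun x : G => set_val H (x ^ g^-1)) \in @subgroups G.
Proof.
have := set_valP H; rewrite inE /subgroups /=.
move=> [H1 HB]; split=> [|x y]; rewrite !unfold_in ?conj1g //.
rewrite conjMg conjVg => Hx Hy; exact: HB.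
Qed.

(* [g^-1 H g]: [x] belongs to it iff [g x g^-1] belongs to [H]. *)
Definition conj_subgroup (g : G) (H : subgroupSpace G) : subgroupSpace G :=
  exist (fun S => S \in @subgroups G) _ (conj_subgroup_subproof g H).

(* The subgroup generated by the commutators of elements of [A], as the
   intersection of all the subgroups that contain them. *)
Definition derived (A : set G) : set G :=
  [set g | forall K : subgroupSpace G,
    (forall a b, A a -> A b -> carrier K [~ a, b]) -> carrier K g].

End Subgroups.

Section InvariantRandomSubgroups.
Context {R : realType} {G : groupType}.

Definition is_IRS (mu : probability (borelSub G) R) : Prop :=
  forall (g : G) (A : set (borelSub G)), measurable A ->
    mu ((conj_subgroup g : borelSub G -> borelSub G) @^-1` A) = mu A.

Definition is_ergodic (mu : probability (borelSub G) R) : Prop :=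
  forall A : set (borelSub G), measurable A ->
    (forall g : G,
       (conj_subgroup g : borelSub G -> borelSub G) @^-1` A = A) ->
    mu A = 0%E \/ mu A = 1%E.

(* Library measures are total on [set T], so equality of Borel measures is
   equality on measurable sets. *)
Definition is_dirac_trivial (mu : probability (borelSub G) R) : Prop :=
  forall A : set (borelSub G), measurable A ->
    mu A = @dirac _ (borelSub G) (trivial_subgroup G) R A.

End InvariantRandomSubgroups.

Section Actions.
Context {G : groupType} {X : topologicalType} (act : X -> G -> X).

(* Each [act^~ g] is then a homeomorphism, with inverse [act^~ g^-1]. *)
Record action_by_homeomorphisms : Prop := {
  act1 : forall x, act x 1 = x ;
  actM : forall x g h, act x (g * h) = act (act x g) h ;
  act_continuous : forall g, continuous (act^~ g) }.

Definition faithful_action : Prop :=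
  forall g, (forall x, act x g = x) -> g = 1.

Definition rigid_stabilizer (U : set X) : set G :=
  [set g | forall x, ~ U x -> act x g = x].

Definition fixed_point (A : set G) (x : X) : Prop :=
  forall g, A g -> act x g = x.

End Actions.

(* Main.v *)
Require Import Defs.
From HB Require Import structures.
From mathcomp Require Import all_boot all_order all_algebra.
From mathcomp Require Import all_classical all_reals all_analysis.

(* Fix g and an open W disjoint from Wg, let L = R_G(W), and let J(H) be the
   group of those a in L for which some c in L satisfies c (g a g^-1) \in H.
   Since L commutes with g L g^-1, J(H) does not change when H is conjugated by
   L; and if H contains g^a and g^b with a, b in L, then a b^-1 \in J(H). So if
   L contains n elements t_i that are pairwise independent modulo J(H), the n
   events g^(t_i) \in H are disjoint on an L-invariant event, while by invariance
   each is as likely as g \in H. Hence J(H) almost surely has finite index in L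
   as soon as g \in H.

   From then on H is fixed. For a in J(H) there is a' in R_G(Wg) with a a' \in H.
   Choosing V inside W so that R_G(V) meets the least number of cosets of J(H),
   any a in R_G(V) can be corrected, by an element c supported in a prescribed
   smaller set, so that a c^-1 \in J(H). Doing this for two elements g, h of H
   with W, Wg, Wh disjoint, and with corrections in disjoint sets, gives elements
   a c^-1 a' and b d^-1 b' of H whose commutator is [a, b]. A second element h,
   if only g is given, is itself of the form a c^-1 a'. *)

Set Implicit Arguments.
Unset Strict Implicit.
Unset Printing Implicit Defensive.

Import Order.TTheory GRing.Theory Num.Theory.
Local Open Scope classical_set_scope.
Local Open Scope group_scope.

(** * Subgroups and the counting of cosets *)

Section SubgroupSpace.
Variable G : groupType.
Implicit Types (H : subgroupSpace G) (a b g : G) (L J : set G).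

Lemma carrier1 H : carrier H 1.
Proof. by case: (set_valP H). Qed.

Lemma carrierB H a b : carrier H a -> carrier H b -> carrier H (a * b^-1).
Proof. by case: (set_valP H) => _; apply. Qed.

Lemma carrierV H a : carrier H a -> carrier H a^-1.
Proof. by move=> Ha; rewrite -[a^-1]mul1g; apply: carrierB (carrier1 H) Ha. Qed.

Lemma carrierM H a b : carrier H a -> carrier H b -> carrier H (a * b).
Proof. by move=> Ha Hb; rewrite -[b]invgK; apply/carrierB/carrierV. Qed.

Lemma carrierJ H a b : carrier H a -> carrier H b -> carrier H (a ^ b).
Proof.
by move=> Ha Hb; rewrite conjgE; apply: carrierM (carrierM Ha Hb); exact: carrierV.
Qed.

Lemma carrierR H a b : carrier H a -> carrier H b -> carrier H [~ a, b].
Proof.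
by move=> Ha Hb; rewrite commgEl; apply: carrierM (carrierJ Ha Hb); exact: carrierV.
Qed.

Definition coset_independent J : seq G -> bool :=
  pairwise (fun a b => `[< ~ J (a * b^-1) >]).

(** For a subgroup [J], included in [L] or not, this bounds the number of right cosets [J a] with
    [a] in [L]. *)
Definition has_finite_index L J : Prop :=
  exists n, forall s, {in s, forall a, L a} -> coset_independent J s ->
    (size s <= n)%N.

(* [V] is chosen so that the group [K V] meets the least number of cosets of [J]. *)
Lemma least_coset_image (T : Type) (F : set T) (K : T -> set G) J V0 :
  F V0 -> has_finite_index (K V0) J ->
  exists2 V, F V & forall V1, F V1 -> K V1 `<=` K V ->
    forall a, K V a -> exists2 c, K V1 c & J (a * c^-1).
Proof.
move=> FV0 [n0 Jn0].
pose P n := `[< exists2 V, F V & forall s, {in s, forall a, K V a} ->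
  coset_independent J s -> (size s <= n)%N >].
have exP : exists n, P n by exists n0; apply/asboolP; exists V0.
case: (ex_minnP exP) => m /asboolP[V FV Vm] mmin; exists V => // V1 FV1 V1V a Va.
apply: contrapT => noc.
(* By minimality of [m], [K V1] still has [m] independent elements; [a] in front would make [m + 1]
   of them in [K V]. *)
have [s [sV1 sJ ms]] : exists s, [/\ {in s, forall a, K V1 a},
    coset_independent J s & (m <= size s)%N].
  case: m Vm mmin => [|m] Vm mmin; first by exists [::].
  apply: contrapT => nos.
  suff /mmin : P m by rewrite ltnn.
  apply/asboolP; exists V1 => // s sV1 sJ; rewrite leqNgt; apply/negP => ms.
  by apply: nos; exists s.
have : (size (a :: s) <= m)%N.
  apply: Vm => [b|].
    by rewrite inE => /orP[/eqP->//|/sV1/V1V].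
  rewrite /coset_independent /=; apply/andP; split=> //.
  apply/allP => c /sV1 V1c; apply/asboolP => Jac; apply: noc; by exists c.
by rewrite /= ltnNge ms.
Qed.

Lemma commg_mul_commute a b a2 b2 :
  commute a a2 -> commute b b2 -> commute a b2 -> commute a2 b ->
  commute a2 b2 -> [~ a * a2, b * b2] = [~ a, b].
Proof.
move=> aa2 bb2 ab2 a2b a2b2.
have cc (x y : G) : commute x y -> x ^ y = x by move=> xy; rewrite conjgE xy mulKg.
rewrite !commgEl conjMg (cc a2) ?conjgM; last exact: commuteM.
rewrite -conjgM bb2 conjgM (cc a b2)// invgM.
have /commute_sym aba2 : commute a2 (a^-1 * a ^ b).
  apply: commuteM; first exact/commuteV/commute_sym.
  rewrite conjgE; apply: commuteM; first exact: commuteV.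
  by apply: commuteM => //; exact: commute_sym.
by rewrite -(mulgA a2^-1) (mulgA a^-1) aba2 mulKg.
Qed.
End SubgroupSpace.

(** * Rigid stabilizers, and absorption modulo [J(H)] *)

Section Action.
Context {G : groupType} {X : topologicalType} (act : X -> G -> X).
Hypothesis X_hausdorff : hausdorff_space X.
Hypothesis act_homeo : action_by_homeomorphisms act.
Hypothesis act_faithful : faithful_action act.
Implicit Types (H : subgroupSpace G) (U V W : set X) (x y : X) (a b c g h : G).

Local Notation RS := (rigid_stabilizer act).
Local Notation "U .* g" := ((act^~ g) @` U) (at level 40).

Lemma actK g : cancel (act^~ g) (act^~ g^-1).
Proof. by move=> x; rewrite -(actM act_homeo) mulgV (act1 act_homeo). Qed.

Lemma actVK g : cancel (act^~ g^-1) (act^~ g).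
Proof. by move=> x; rewrite -(actM act_homeo) mulVg (act1 act_homeo). Qed.

Lemma rigidM U a b : RS U a -> RS U b -> RS U (a * b).
Proof. by move=> Ua Ub x Ux; rewrite (actM act_homeo) Ua// Ub. Qed.

Lemma rigidV U a : RS U a -> RS U a^-1.
Proof. by move=> Ua x Ux; rewrite -{1}(Ua _ Ux) actK. Qed.

Lemma rigidS U V : U `<=` V -> RS U `<=` RS V.
Proof. by move=> UV a Ua x Vx; apply: Ua => /UV. Qed.

Lemma rigid_stable U a x : RS U a -> U x -> U (act x a).
Proof.
move=> Ua Ux; apply: contrapT => Uxa.
by apply: (Uxa); rewrite -(actK a x) (rigidV Ua Uxa) in Ux.
Qed.

Lemma rigidJ U a g : RS U a -> RS (U .* g) (a ^ g).
Proof.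
move=> Ua x Ugx; rewrite conjgE !(actM act_homeo) Ua ?actVK//.
by move=> Uxg; apply: Ugx; exists (act x g^-1) => //; exact: actVK.
Qed.

Lemma act_ext a b : (forall x, act x a = act x b) -> a = b.
Proof.
move=> ab; apply/eqP; rewrite -[_ == _]divg_eq1; apply/eqP/act_faithful => x.
by rewrite (actM act_homeo) ab actK.
Qed.

Lemma rigid_commute U V a b : U `&` V = set0 -> RS U a -> RS V b -> commute a b.
Proof.
move=> UV Ua Vb; apply: act_ext => x; rewrite !(actM act_homeo).
have UVF y : U y -> ~ V y by move=> Uy Vy; have : (U `&` V) y by []; rewrite UV.
have [Ux|Ux] := pselect (U x).
  by rewrite !Vb //; apply: UVF => //; exact: rigid_stable.
have [Vx|Vx] := pselect (V x); last by rewrite Ua // Vb// Ua.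
rewrite !Ua // => Uxb; apply: (UVF _ Uxb); exact: rigid_stable.
Qed.

Lemma translateV_disjoint W g : W `&` (W .* g) = set0 -> W `&` (W .* g^-1) = set0.
Proof.
rewrite -!subset0 => Wg x [Wx [y Wy yx]]; apply: (Wg y); split => //.
by exists x => //; rewrite -yx actVK.
Qed.

Lemma derived_sub H (A : set G) :
  (forall a b, A a -> A b -> carrier H [~ a, b]) -> derived A `<=` carrier H.
Proof. by move=> AH g; apply. Qed.

(* Conjugated by [g^-1], this is the projection to [RS (W .* g^-1)] of the
   intersection of [H] with [RS W * RS (W .* g^-1)]. *)
Definition companioned W g H : set G :=
  [set a | RS W a /\ exists2 c, RS W c & carrier H (c * a ^ g^-1)].

(** Elements of [RS W] and [RS (W .* g^-1)] commute, so the quotient of the two witnesses can be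
    sorted into a witness for [a * b^-1]. *)
Lemma companionedB W g H a b : W `&` (W .* g) = set0 ->
  companioned W g H a -> companioned W g H b -> companioned W g H (a * b^-1).
Proof.
move=> Wg [Wa [c Wc Ha]] [Wb [d Wd Hb]].
split; first exact/rigidM/rigidV.
exists (c * d^-1); first exact/rigidM/rigidV.
have dab : commute d^-1 ((a * b^-1) ^ g^-1).
  apply: rigid_commute (translateV_disjoint Wg) (rigidV Wd) (rigidJ _).
  exact/rigidM/rigidV.
rewrite -mulgA dab conjMg conjVg !mulgA; have := carrierB Ha Hb.
by rewrite invgM !mulgA.
Qed.

(** Conjugating [c * a ^ g^-1] by [g], which lies in [H], gives [c ^ g * a], whose factors
    commute. *)
Lemma companionedP W g H a : W `&` (W .* g) = set0 -> carrier H g ->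
  companioned W g H a ->
  exists2 a', RS (W .* g) a' & carrier H (a * a').
Proof.
move=> Wg Hg [Wa [c Wc Hca]]; exists (c ^ g); first exact: rigidJ.
have -> : a * c ^ g = (c * a ^ g^-1) ^ g; last exact: carrierJ.
by rewrite conjMg conjgKV; apply: rigid_commute Wa (rigidJ Wc).
Qed.

(** Equivalently, [RS V] is contained in the product set [J * RS V1]. It serves with [V] and [V1]
    disjoint, to trade an element for one supported elsewhere. *)
Definition absorbs (J : set G) V V1 :=
  forall a, RS V a -> exists2 c, RS V1 c & J (a * c^-1).

Lemma absorbsS J U V V1 : U `<=` V -> absorbs J V V1 -> absorbs J U V1.
Proof. by move=> UV JV a /(rigidS UV)/JV. Qed.

(** Both [r^-1 * c0^-1] and [a * r^-1 * c^-1] lie in [J]; the second times the inverse of the first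
    is [a] times the inverse of [(c0^-1 * c) ^ r]. In (ii) two neighbourhoods of [x] always meet, so
    a disjoint absorbing set is obtained as a translate. *)
Lemma absorbs_translate J V V1 r : (forall a b, J a -> J b -> J (a * b^-1)) ->
  absorbs J V V1 -> RS V r -> absorbs J V (V1 .* r).
Proof.
move=> JB JV Vr a Va.
have [c0 V1c0 Jc0] := JV _ (rigidV Vr).
have [c V1c Jc] := JV _ (rigidM Va (rigidV Vr)).
exists ((c0^-1 * c) ^ r); first by apply/rigidJ/rigidM => //; exact: rigidV.
have := JB _ _ Jc Jc0; congr J.
by rewrite conjgE !invgM !invgK !mulgA.
Qed.

(** [F] will be the non-empty open sets in (i), and the open neighbourhoods of [x] in (ii). *)
Lemma absorbs_family (F : set (set X)) J W V0 :
  has_finite_index (RS W) J -> F V0 -> V0 `<=` W ->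
  exists V, [/\ F V, V `<=` V0 & forall V1, F V1 -> V1 `<=` V -> absorbs J V V1].
Proof.
move=> [n Jn] FV0 V0W.
have [||V [FV VV0] JV] := @least_coset_image G _ [set V | F V /\ V `<=` V0] RS J V0.
- by split.
- by exists n => s sV0; apply: Jn => a /sV0; exact: rigidS.
exists V; split=> // V1 FV1 V1V a; apply: JV; last exact: rigidS.
by split => //; apply: subset_trans VV0.
Qed.

Lemma derived_rigid_sub H W g h V1 V2 V3 :
  carrier H g -> carrier H h ->
  W `&` (W .* g) = set0 -> W `&` (W .* h) = set0 -> (W .* g) `&` (W .* h) = set0 ->
  V1 `<=` W -> V2 `<=` W -> V3 `<=` W ->
  V1 `&` V2 = set0 -> V1 `&` V3 = set0 -> V2 `&` V3 = set0 ->
  absorbs (companioned W g H) V1 V2 -> absorbs (companioned W h H) V1 V3 ->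
  derived (RS V1) `<=` carrier H.
Proof.
move=> Hg Hh Wg Wh gh V1W V2W V3W V12 V13 V23 absg absh.
apply: derived_sub => a b V1a V1b.
have [c2 V2c2 /(companionedP Wg Hg)[a' ga' Ha]] := absg _ V1a.
have [c3 V3c3 /(companionedP Wh Hh)[b' hb' Hb]] := absh _ V1b.
(* The corrections to [a] and [b] are supported in [S2] and [S3]. These are disjoint from [V1] and
   from each other, so the corrections drop out of the commutator. *)
pose S2 := V2 `|` W .* g; pose S3 := V3 `|` W .* h.
have S2a : RS S2 (c2^-1 * a').
  by apply: rigidM; [apply: rigidS (rigidV V2c2)|apply: rigidS ga'] => ?; [left|right].
have S3b : RS S3 (c3^-1 * b').
  by apply: rigidM; [apply: rigidS (rigidV V3c3)|apply: rigidS hb'] => ?; [left|right].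
have V1S2 : V1 `&` S2 = set0 by rewrite setIUr V12 set0U; apply: subsetI_eq0 Wg.
have V1S3 : V1 `&` S3 = set0 by rewrite setIUr V13 set0U; apply: subsetI_eq0 Wh.
have S23 : S2 `&` S3 = set0.
  rewrite setIUr !setIUl V23 gh set0U setU0.
  by rewrite (setIC _ V3) (subsetI_eq0 V3W _ Wg)// (subsetI_eq0 V2W _ Wh)// !setU0.
rewrite -(@commg_mul_commute G a b (c2^-1 * a') (c3^-1 * b')).
- by apply: carrierR; rewrite mulgA.
- exact: rigid_commute V1S2 V1a S2a.
- exact: rigid_commute V1S3 V1b S3b.
- exact: rigid_commute V1S3 V1a S3b.
- exact/commute_sym/(rigid_commute V1S2 V1b S2a).
- exact: rigid_commute S23 S2a S3b.
Qed.

(** In [h = a * c^-1 * a'] the last two factors fix [V1] pointwise, being supported in [V2] and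
    [W .* g]. *)
Lemma exists_second_mover H W g V1 V2 a :
  carrier H g -> W `&` (W .* g) = set0 -> V1 `<=` W -> V1 `&` V2 = set0 ->
  absorbs (companioned W g H) V1 V2 -> RS V1 a ->
  exists2 h, carrier H h & forall y, V1 y -> act y h = act y a.
Proof.
move=> Hg Wg V1W V12 absg V1a.
have [c V2c /(companionedP Wg Hg)[a' ga' Ha]] := absg _ V1a.
exists (a * c^-1 * a') => // y V1y.
have V1ya : V1 (act y a) by exact: rigid_stable.
rewrite !(actM act_homeo) (rigidV V2c); last first.
  by move=> V2y; have : (V1 `&` V2) (act y a) by []; rewrite V12.
apply: ga' => Wgy; have : (W `&` W .* g) (act y a) by split => //; exact: V1W.
by rewrite Wg.
Qed.

(** * Hausdorff separation of a point and its images *)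

Lemma separate_images x g h : act x g <> act x h ->
  exists U, [/\ open U, U x & (U .* g) `&` (U .* h) = set0].
Proof.
move: X_hausdorff; rewrite open_hausdorff => sep /eqP/sep.
move=> [[A C] /= [xA xC] [oA oC /eqP AC]].
exists ((act^~ g) @^-1` A `&` (act^~ h) @^-1` C); split.
- by apply: openI; apply: open_comp => // y _; exact: act_continuous act_homeo _ _.
- by split => /=; [rewrite -in_setE|rewrite -in_setE].
- rewrite -subset0 => _ [[y [Ay _] <-] [z [_ Cz] zy]]; rewrite -AC; split => //.
  by rewrite -zy.
Qed.

Lemma translate1 U : U .* 1 = U.
Proof.
rewrite (_ : act^~ 1 = id) ?image_id//.
by apply/funext => x; exact: act1 act_homeo x.
Qed.

Lemma separate_image x g : act x g <> x ->
  exists U, [/\ open U, U x & U `&` (U .* g) = set0].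
Proof.
rewrite -{2}[x](act1 act_homeo) => /nesym/separate_images[U [oU Ux]].
by rewrite translate1 => Ug; exists U.
Qed.

Lemma separate_points U x y : open U -> U x -> U y -> x <> y ->
  exists V1 V2, [/\ open V1 /\ V1 x, open V2 /\ V2 y,
    V1 `<=` U, V2 `<=` U & V1 `&` V2 = set0].
Proof.
move=> oU Ux Uy; move: X_hausdorff; rewrite open_hausdorff => sep /eqP/sep.
move=> [[A C] /= [/set_mem Ax /set_mem Cy] [oA oC /eqP AC]].
exists (U `&` A), (U `&` C); split; do ?[exact: subIsetl].
- by split=> //; exact: openI.
- by split=> //; exact: openI.
- by rewrite setIACA AC setI0.
Qed.

(** * Both conclusions for a fixed subgroup [H] *)

Variable B : set (set X).
Hypothesis B_basis : basis B.

Lemma basis_sub U x : open U -> U x -> exists W, [/\ B W, open W, W x & W `<=` U].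
Proof.
move=> oU Ux; have [BO /(_ x U)[]] := B_basis; first exact: open_nbhs_nbhs.
by move=> W [BW Wx] WU; exists W; split=> //; exact: BO.
Qed.

Lemma basic_mover x g : act x g <> x ->
  exists W, [/\ B W, open W, W x & W `&` (W .* g) = set0].
Proof.
move=> /separate_image[U [oU Ux Ug]].
have [W [BW oW Wx WU]] := basis_sub oU Ux.
by exists W; split=> //; apply: subsetI_eq0 Ug => //; exact: image_subset.
Qed.

Lemma basic_movers x g h : act x g <> x -> act x h <> x -> act x g <> act x h ->
  exists W, [/\ B W, open W /\ W x, W `&` (W .* g) = set0, W `&` (W .* h) = set0
    & (W .* g) `&` (W .* h) = set0].
Proof.
move=> /separate_image[U1 [oU1 U1x U1g]] /separate_image[U2 [oU2 U2x U2h]].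
move=> /separate_images[U3 [oU3 U3x U3gh]].
have [W [BW oW Wx WU]] : exists W, [/\ B W, open W, W x & W `<=` U1 `&` U2 `&` U3].
  by apply: basis_sub => //; do 2?[apply: openI => //].
have W1 : W `<=` U1 by move=> y /WU[[]].
have W2 : W `<=` U2 by move=> y /WU[[]].
have W3 : W `<=` U3 by move=> y /WU[].
by exists W; split=> //; [apply: subsetI_eq0 U1g|apply: subsetI_eq0 U2h|
  apply: subsetI_eq0 U3gh] => //; exact: image_subset.
Qed.

(** With [W] restricted to a basis, chosen countable later, this is a countable conjunction over [W]
    and [g], so it can be shown almost surely one pair at a time. *)
Definition virtually_full H := forall W, B W -> forall g, carrier H g ->
  W `&` (W .* g) = set0 -> has_finite_index (RS W) (companioned W g H).

Lemma derived_rigid_nonempty H g : virtually_full H -> carrier H g -> g <> 1 ->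
  exists U, [/\ open U, U !=set0 & derived (RS U) `<=` carrier H].
Proof.
move=> fullH Hg g1; apply: contrapT => noU.
(* If [RS V] were trivial, its derived group would be too, and [V] itself would be the desired
   set. *)
have mover V : open V -> V !=set0 -> exists a x, [/\ RS V a, V x & act x a <> x].
  move=> oV V0; apply: contrapT => nomover; apply: noU; exists V; split => //.
  have RS1 a : RS V a -> a = 1.
    move=> Va; apply: act_faithful => x; apply: contrapT => xa; apply: nomover.
    by exists a, x; split => //; apply: contrapT => /Va.
  by apply: derived_sub => a b /RS1-> _; rewrite comm1g; exact: carrier1.
pose F := [set V : set X | open V /\ V !=set0].
have split V : F V -> exists V1 V2, [/\ F V1, F V2, V1 `<=` V, V2 `<=` V &
    V1 `&` V2 = set0].
  move=> [oV V0]; have [a [x [Va Vx xa]]] := mover V oV V0.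
  have [V1 [V2 [[oV1 V1x] [oV2 V2x] V1V V2V V12]]] :=
    separate_points oV (rigid_stable Va Vx) Vx xa.
  by exists V1, V2; split => //; split => //; [exists (act x a)|exists x].
have [x xg] : exists x, act x g <> x.
  by apply: contrapT => nox; apply: g1; apply: act_faithful => x;
     apply: contrapT => xg; apply: nox; exists x.
(* On [V1], [h] acts as some [a] in [RS V1] that moves [y]. Thus [h] keeps [y] inside [W], while [g]
   takes it out. *)
have [y [h [Hh yg yh ygh]]] : exists y h,
    [/\ carrier H h, act y g <> y, act y h <> y & act y g <> act y h].
  have [W [BW oW Wx Wg]] := basic_mover xg.
  have FW : F W by split=> //; exists x.
  have [V [FV VW absV]] := absorbs_family (fullH W BW g Hg Wg) FW (@subset_refl _ W).
  have [V1 [V2 [[oV1 V10] FV2 V1V V2V V12]]] := split V FV.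
  have [a [y [V1a V1y ya]]] := mover V1 oV1 V10.
  have V1W := subset_trans V1V VW.
  have [h Hh ha] := exists_second_mover Hg Wg V1W V12
    (absorbsS V1V (absV V2 FV2 V2V)) V1a.
  have WgF z : W z -> ~ W (act z g).
    move=> Wz Wzg; have : (W `&` W .* g) (act z g) by split=> //; exists z.
    by rewrite Wg.
  exists y, h; split => //.
  - by move=> yg; apply: (WgF y); [exact: V1W|rewrite yg; exact: V1W].
  - by rewrite ha.
  - rewrite ha// => yga; apply: (WgF y); first exact: V1W.
    by rewrite yga; apply: V1W; exact: rigid_stable.
have [W [BW [oW Wy] Wg Wh gh]] := basic_movers yg yh ygh.
have FW : F W by split=> //; exists y.
have [V [FV VW absg]] := absorbs_family (fullH W BW g Hg Wg) FW (@subset_refl _ W).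
(* Choosing [V'] inside [V] makes the absorption for [g] and the one for [h] both available on
   [V']. *)
have [V' [FV' V'V absh]] := absorbs_family (fullH W BW h Hh Wh) FV VW.
have [V1 [U [FV1 FU V1V' UV' V1U]]] := split V' FV'.
have [V2 [V3 [FV2 FV3 V2U V3U V23]]] := split U FU.
have V2V' := subset_trans V2U UV'; have V3V' := subset_trans V3U UV'.
have V'W := subset_trans V'V VW; case: (FV1) => oV1 V10.
apply: noU; exists V1; split => //.
apply: (derived_rigid_sub Hg Hh Wg Wh gh _ _ _ _ _ V23);
  try by apply: subset_trans V'W.
- by apply: subsetI_eq0 V1U.
- by apply: subsetI_eq0 V1U.
- apply: absorbsS (absg _ FV2 _); first exact: subset_trans V'V.
  exact: subset_trans V'V.
- exact: absorbsS V1V' (absh _ FV3 _).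
Qed.

(** The scheme of (i), with [x] itself in place of [y]. Of disjoint sets only one contains [x], so
    translates [V1 .* r] and [V1 .* s] of a neighbourhood [V1] take the roles of [V2] and [V3]. *)
Lemma derived_rigid_nbhs H x :
  (forall V, open V -> forall y, V y -> ~ fixed_point act (RS V) y) ->
  virtually_full H -> ~ fixed_point act (carrier H) x ->
  exists U, [/\ open U, U x & derived (RS U) `<=` carrier H].
Proof.
move=> nofix fullH.
have nofixE A : ~ fixed_point act A x -> exists2 a, A a & act x a <> x.
  by move=> Ax; apply: contrapT => noa; apply: Ax => a Aa;
     apply: contrapT => xa; apply: noa; exists a.
have mover V : open V -> V x -> exists2 a, RS V a & act x a <> x.
  by move=> oV Vx; apply: nofixE; exact: nofix Vx.
move=> /nofixE[g Hg xg].
pose F := [set V : set X | open V /\ V x].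
have compB W f : W `&` (W .* f) = set0 -> forall a b, companioned W f H a ->
  companioned W f H b -> companioned W f H (a * b^-1).
  by move=> Wf a b; exact: companionedB.
have shrink V r s : F V -> act x r <> x -> act x s <> x -> act x r <> act x s ->
  exists V1, [/\ F V1, V1 `<=` V, V1 `&` (V1 .* r) = set0, V1 `&` (V1 .* s) = set0
    & (V1 .* r) `&` (V1 .* s) = set0].
  move=> [oV Vx] xr xs rs.
  have [W [_ [oW Wx] Wr Ws Wrs]] := basic_movers xr xs rs.
  exists (V `&` W); split; first by split=> //; exact: openI.
  - exact: subIsetl.
  - by apply: subsetI_eq0 Wr; [|apply: image_subset]; exact: subIsetr.
  - by apply: subsetI_eq0 Ws; [|apply: image_subset]; exact: subIsetr.
  - by apply: subsetI_eq0 Wrs; apply: image_subset; exact: subIsetr.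
have shift V V1 r : RS V r -> V1 `<=` V -> V1 .* r `<=` V.
  by move=> Vr V1V _ [y V1y <-]; apply: rigid_stable => //; exact: V1V.
(* [s] is taken in [RS V2], so [act x s] stays in [V2], away from [act x r], which lies in [V1]. *)
have two V : F V -> exists r s, [/\ RS V r, RS V s & [/\ act x r <> x, act x s <> x
    & act x r <> act x s]].
  move=> [oV Vx]; have [r Vr xr] := mover V oV Vx.
  have [V1 [V2 [[oV1 V1x] [oV2 V2x] V1V V2V V12]]] :=
    separate_points oV (rigid_stable Vr Vx) Vx xr.
  have [s V2s xs] := mover V2 oV2 V2x.
  exists r, s; split => //; first exact: rigidS V2s.
  split => // rs; have : (V1 `&` V2) (act x r).
    by split => //; rewrite rs; exact: rigid_stable.
  by rewrite V12.
have [h [Hh xh xgh]] : exists h, [/\ carrier H h, act x h <> x & act x g <> act x h].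
  have [W [BW oW Wx Wg]] := basic_mover xg.
  have FW : F W by [].
  have [V [FV VW absV]] := absorbs_family (fullH W BW g Hg Wg) FW (@subset_refl _ W).
  have [r [s [Vr Vs [xr xs rs]]]] := two V FV.
  have [V1 [FV1 V1V V1r _ _]] := shrink V r s FV xr xs rs.
  have [a V1a xa] := mover V1 FV1.1 FV1.2.
  have abs1 := absorbs_translate (compB _ _ Wg) (absV _ FV1 V1V) Vr.
  have V1W := subset_trans V1V VW.
  have [h Hh ha] := exists_second_mover Hg Wg V1W V1r (absorbsS V1V abs1) V1a.
  have V1x := FV1.2; exists h; split => //; first by rewrite ha.
  rewrite ha// => xga; have : (W `&` W .* g) (act x g).
    by split; [rewrite xga; apply: V1W; exact: rigid_stable|exists x].
  by rewrite Wg.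
have [W [BW [oW Wx] Wg Wh gh]] := basic_movers xg xh xgh.
have FW : F W by [].
have [V [FV VW absg]] := absorbs_family (fullH W BW g Hg Wg) FW (@subset_refl _ W).
have [V' [FV' V'V absh]] := absorbs_family (fullH W BW h Hh Wh) FV VW.
have [r [s [Vr Vs [xr xs rs]]]] := two V' FV'.
have [V1 [FV1 V1V V1r V1s V1rs]] := shrink V' r s FV' xr xs rs.
have V'W := subset_trans V'V VW.
exists V1; split; [exact: FV1.1|exact: FV1.2|].
apply: (derived_rigid_sub Hg Hh Wg Wh gh _ _ _ V1r V1s V1rs).
- exact: subset_trans V'W.
- by apply: subset_trans V'W; exact: shift.
- by apply: subset_trans V'W; exact: shift.
- apply: (absorbsS V1V); apply: absorbs_translate (compB _ _ Wg) _ Vr.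
  exact: absorbsS V'V (absg _ FV1 (subset_trans V1V V'V)).
- apply: (absorbsS V1V); apply: absorbs_translate (compB _ _ Wh) _ Vs.
  exact: absh FV1 V1V.
Qed.

End Action.

(** * Countable families of events and disjoint copies of an event *)

Section Measure.
Context d (T : measurableType d) (R : realType) (mu : probability T R).

Lemma measurable_and (P : Prop) (A : set T) :
  measurable A -> measurable [set x | P /\ A x].
Proof.
move=> mA; have [p|np] := pselect P.
  by rewrite (_ : [set _ | _] = A)//; apply/seteqP; split=> // x [].
by rewrite (_ : [set _ | _] = set0)//; apply/seteqP; split=> // x [].
Qed.

Lemma ae_countable I (D : set I) (P : I -> T -> Prop) : countable D ->
  (forall i, D i -> {ae mu, forall x, P i x}) ->
  {ae mu, forall x, forall i, D i -> P i x}.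
Proof.
move=> /pfcard_geP[->|[e]] aeP; first by apply: aeW.
have : {ae mu, forall x, forall n, P (e n) x}.
  by apply: ae_foralln => n; apply: aeP; exact: funS.
apply: filterS => x Px i Di.
by have [n _ en] := @surj _ _ _ _ e i Di; rewrite -en; exact: Px.
Qed.

Lemma mem_seqDU (F : nat -> set T) n x :
  seqDU F n x <-> F n x /\ forall k, (k < n)%N -> ~ F k x.
Proof.
rewrite /seqDU -bigcup_mkord; split=> -[Fx nF]; split => //.
  by move=> k kn Fk; apply: nF; exists k.
by move=> [k /= kn /(nF k kn)].
Qed.

(* The copies [\bigcup_k (seqDU E k `&` F k i)], for [i < n], are pairwise
   disjoint and have the same measure as [\bigcup_k E k `&` A]. *)
Lemma measure_disjoint_copies n (E : nat -> set T) (A : set T)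
    (F : nat -> 'I_n -> set T) :
  (forall k, measurable (E k)) -> measurable A ->
  (forall k i, measurable (F k i)) ->
  (forall k i, mu (seqDU E k `&` F k i) = mu (seqDU E k `&` A)) ->
  (forall k, trivIset [set: 'I_n] (fun i => E k `&` F k i)) ->
  (\sum_(i < n) mu (\bigcup_k E k `&` A) <= 1)%E.
Proof.
move=> mE mA mF FA Fdisj.
pose S i := \bigcup_k (seqDU E k `&` F k i).
have mD k : measurable (seqDU E k) by exact: seqDU_measurable.
have mS i : measurable (S i) by apply: bigcupT_measurable => k; exact: measurableI.
have tD (B : nat -> set T) : trivIset setT (fun k => seqDU E k `&` B k).
  have := trivIset_seqDU E; move=> tE k l _ _ [x [[Ek _] [El _]]].
  by apply: tE => //; exists x.
have muS i : mu (S i) = mu (\bigcup_k E k `&` A).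
  have mSA (B : nat -> set T) : (forall k, measurable (B k)) ->
      measurable (\bigcup_k (seqDU E k `&` B k)).
    by move=> mB; apply: bigcupT_measurable => k; exact: measurableI.
  rewrite seqDU_bigcup_eq setI_bigcupl !measure_semi_bigcup//; last first.
  - exact: mSA.
  - by move=> k; exact: measurableI.
  - exact: mSA.
  - by move=> k; exact: measurableI.
  by apply: eq_eseriesr => k _; exact: FA.
have -> : (\sum_(i < n) mu (\bigcup_k E k `&` A) = \sum_(i < n) mu (S i))%E.
  by apply: eq_bigr => i _; rewrite muS.
rewrite -measure_bigsetU_ord//.
  by apply: probability_le1; exact: bigsetU_measurable.
move=> i j _ _ [x [[k _ [/mem_seqDU[Ek nE] Fi]] [l _ [/mem_seqDU[El nE'] Fj]]]].
(* Membership of [x] in [seqDU E k] makes [k] the first index with [x] in [E k]. *)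
have kl : k = l.
  by case: (ltngtP k l) => // [/nE'|/nE].
by apply: (Fdisj k) => //; exists x; split; split => //; rewrite kl.
Qed.

Lemma probability_eq0_of_sums (A : set T) : measurable A ->
  (forall n, \sum_(i < n) mu A <= 1)%E -> mu A = 0%E.
Proof.
move=> mA; have : mu A \is a fin_num by exact: fin_num_measure.
move=> /fineK <- bound; congr EFin.
apply/eqP; rewrite eq_le fine_ge0 ?andbT//.
rewrite leNgt; apply/negP => r0.
(* This [n] exceeds [1 / mu A], so the sum of [n] terms exceeds 1. *)
pose n := Num.bound (fine (mu A))^-1.
have := bound n; rewrite sumEFin sumr_const card_ord lee_fin leNgt => /negP; apply.
rewrite -mulr_natl -ltr_pdivrMr// div1r.
by apply: archi_boundP; rewrite invr_ge0 ltW.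
Qed.

End Measure.

(** * Measurability on the space of subgroups *)

Section BorelSub.
Context {G : groupType}.

Lemma measurable_carrier (g : G) : measurable [set H : borelSub G | carrier H g].
Proof.
apply: sub_sigma_algebra.
rewrite /= (_ : [set _ | _] =
  (set_val : subgroupSpace G -> prod_topology (fun=> bool)) @^-1`
    ((@proj G (fun=> bool) g) @^-1` [set true])); last by apply/seteqP; split.
apply: open_comp => [H _|]; first exact: initial_continuous.
apply: open_comp => [f _|]; first exact: proj_continuous.
exact: discrete_open.
Qed.

Lemma measurable_coset_independent (J : borelSub G -> set G) :
  (forall a, measurable [set H | J H a]) ->
  forall s, measurable [set H | coset_independent (J H) s].
Proof.
move=> mJ; have mJall a s : measurable [set H | all (fun b => `[< ~ J H (a * b^-1) >]) s].
  elim: s => [|b s IHs] /=; first by rewrite (_ : [set _ | _] = setT)//; apply/seteqP.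
  rewrite (_ : [set _ | _] = ~` [set H | J H (a * b^-1)] `&`
    [set H | all (fun b => `[< ~ J H (a * b^-1) >]) s]).
    by apply: measurableI => //; exact: measurableC.
  apply/seteqP; split=> H /=; first by move=> /andP[/asboolP].
  by move=> [? ?]; apply/andP; split => //; exact/asboolP.
elim=> [|a s IHs]; first by rewrite (_ : [set _ | _] = setT)//; apply/seteqP.
rewrite (_ : [set _ | _] = [set H | all (fun b => `[< ~ J H (a * b^-1) >]) s] `&`
    [set H | coset_independent (J H) s]); first exact: measurableI.
by apply/seteqP; split=> H /=; [move=> /andP|move=> [? ?]; apply/andP; split].
Qed.

Lemma carrier_conj (b : G) (H : subgroupSpace G) a :
  carrier (conj_subgroup b H) a = carrier H (a ^ b^-1).
Proof. by []. Qed.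

Lemma carrier_inj (H K : subgroupSpace G) : carrier H = carrier K -> H = K.
Proof.
move=> HK; apply: val_inj; apply/funext => g; apply/idP/idP => [Hg|Kg].
  by have : carrier K g by rewrite -HK.
by have : carrier H g by rewrite HK.
Qed.

End BorelSub.

(** * Almost sure finite index of [J(H)] when [g] lies in [H] *)

Section FiniteIndex.
Context {G : groupType} {X : topologicalType} (act : X -> G -> X).
Hypothesis G_countable : countable [set: G].
Hypothesis act_homeo : action_by_homeomorphisms act.
Hypothesis act_faithful : faithful_action act.
Variables (W : set X) (g : G).
Hypothesis Wg : W `&` ((act^~ g) @` W) = set0.
Implicit Types (H : borelSub G) (a b : G).

Local Notation L := (rigid_stabilizer act W).
Local Notation J := (companioned act W g).

Lemma commute_conj_rigid a b : L a -> L b -> commute b (a ^ g^-1).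
Proof.
move=> La Lb.
apply: (rigid_commute act_homeo act_faithful (translateV_disjoint act_homeo Wg) Lb).
exact: rigidJ.
Qed.

Lemma rigid_conj_stable a b : L a -> L b -> L (a ^ b).
Proof.
move=> La Lb; rewrite conjgE.
by do 2?[apply: (rigidM act_homeo) => //]; exact: (rigidV act_homeo).
Qed.

(** Conjugation by [b] or [b^-1] fixes [a ^ g^-1] and keeps the witness [c] in [L]. *)
Lemma companioned_conj b H : L b -> J (conj_subgroup b H : borelSub G) = J H.
Proof.
move=> Lb; have LVb := rigidV act_homeo Lb.
apply/seteqP; split=> a [La [c Lc Hc]]; split=> //.
  exists (c ^ b^-1); first exact: rigid_conj_stable.
  move: Hc; rewrite carrier_conj conjMg (conjgE (a ^ g^-1) b^-1).
  by rewrite -(commute_conj_rigid La LVb) mulKg.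
exists (c ^ b); first exact: rigid_conj_stable.
rewrite carrier_conj conjMg conjgK (conjgE (a ^ g^-1) b^-1).
by rewrite -(commute_conj_rigid La LVb) mulKg.
Qed.

(** The quotient of [g ^ a] by [g ^ b] is [a^-1 * (a * b^-1) ^ g^-1 * b], and [b] commutes with the
    middle factor. *)
Lemma companioned_of_conj a b H : L a -> L b ->
  carrier H (g ^ a) -> carrier H (g ^ b) -> J H (a * b^-1).
Proof.
move=> La Lb Ha Hb; have LVb := rigidV act_homeo Lb.
have LVa := rigidV act_homeo La; have Lab := rigidM act_homeo La LVb.
split=> //; exists (a^-1 * b); first exact: (rigidM act_homeo).
have := carrierB Ha Hb; congr (carrier H).
rewrite -(mulgA a^-1 b) (commute_conj_rigid Lab Lb) !conjgE !invgM !invgK.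
by rewrite !mulgA.
Qed.

Lemma measurable_companioned a : measurable [set H : borelSub G | J H a].
Proof.
apply: (@measurable_and _ _ (L a) [set H : borelSub G |
  exists2 c, L c & carrier H (c * a ^ g^-1)]).
rewrite (_ : [set _ | _] =
    \bigcup_c [set H : borelSub G | L c /\ carrier H (c * a ^ g^-1)]).
  apply: countable_bigcupT_measurable => // c.
  by apply: measurable_and; exact: measurable_carrier.
by apply/seteqP; split=> H [c]; [move=> Lc Hc; exists c|move=> _ [Lc Hc]; exists c].
Qed.

Context {R : realType} (mu : probability (borelSub G) R).
Hypothesis mu_IRS : is_IRS mu.

(** The independent elements depend on [H]. Splitting by the first [k] with [H] in [E k] fixes them
    on each piece, where invariance applies. *)
Lemma measure_many_cosets n (s_ : nat -> seq G) (E : nat -> set (borelSub G)) :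
  (forall k, E k = [set H : borelSub G | [/\ {in s_ k, forall a, L a},
     coset_independent (J H) (s_ k) & (n <= size (s_ k))%N]]) ->
  measurable (\bigcup_k E k) /\
  (\sum_(i < n) mu (\bigcup_k E k `&` [set H : borelSub G | carrier H g]) <= 1)%E.
Proof.
move=> EE.
(* These two conditions do not depend on [H], so a single member of [E k] settles them. *)
have EL k : E k !=set0 -> {in s_ k, forall a, L a} /\ (n <= size (s_ k))%N.
  by rewrite EE => -[H []].
have mE k : measurable (E k).
  rewrite (_ : E k = [set H : borelSub G |
      ({in s_ k, forall a, L a} /\ (n <= size (s_ k))%N) /\
      coset_independent (J H) (s_ k)]).
    apply: measurable_and; apply: measurable_coset_independent.
    exact: measurable_companioned.
  by rewrite EE; apply/seteqP; split=> H; [case|do 2?case].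
split; first exact: bigcupT_measurable.
(* The default value of [nth] is never reached when [E k] is non-empty, as then
   [i < n <= size (s_ k)]. *)
apply: (measure_disjoint_copies
  (F := fun k i => [set H : borelSub G | carrier H (g ^ nth 1 (s_ k) i)])) => //.
- exact: measurable_carrier.
- by move=> k i; exact: measurable_carrier.
- move=> k i; have [Ek0|/eqP/set0P/EL[sL ns]] := pselect (E k = set0).
    suff -> : seqDU E k = set0 by rewrite !set0I.
    by rewrite -subset0 -Ek0; exact: subDsetl.
  pose t := nth 1 (s_ k) i.
  have Lt : L t^-1.
    by apply/(rigidV act_homeo)/sL/mem_nth; apply: leq_trans ns.
  rewrite -(mu_IRS t^-1
    (A := seqDU E k `&` [set H : borelSub G | carrier H g])); last first.
    by apply: measurableI; [exact: seqDU_measurable|exact: measurable_carrier].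
  congr (mu _); rewrite preimage_setI; congr (_ `&` _); last first.
    by apply/seteqP; split=> H; rewrite /= carrier_conj invgK.
  (* [E j] depends on [H] only through [J H], which conjugation by elements of [L] preserves. *)
  have EJ j H : E j (conj_subgroup t^-1 H : borelSub G) <-> E j H.
    by rewrite EE /= companioned_conj.
  apply/seteqP; split=> H.
    move=> /mem_seqDU[Ek nE]; apply/mem_seqDU; split; first exact/EJ.
    by move=> l /nE nEl /EJ.
  move=> /mem_seqDU[/EJ Ek nE]; apply/mem_seqDU; split => // l /nE nEl El.
  by apply: nEl; apply/EJ.
- move=> k; suff disj (i j : 'I_n) : (i < j)%N ->
    ~ exists H, (E k `&` [set H : borelSub G | carrier H (g ^ nth 1 (s_ k) i)]) H /\
      (E k `&` [set H : borelSub G | carrier H (g ^ nth 1 (s_ k) j)]) H.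
    move=> i j _ _ [H [Hi Hj]]; apply/val_inj; case: (ltngtP i j) => // ij.
      by case: (disj i j ij); exists H.
    by case: (disj j i ij); exists H.
  move=> ij [H [[Ek Hi] [_ Hj]]]; move: (Ek); rewrite EE => -[sL sJ ns].
  have si : (i < size (s_ k))%N by exact: leq_trans ns.
  have sj : (j < size (s_ k))%N by exact: leq_trans ns.
  have /(pairwiseP 1)/(_ i j si sj ij)/asboolP := sJ; apply.
  by apply: companioned_of_conj Hi Hj; apply/sL/mem_nth.
Qed.

Lemma ae_companioned_finite_index :
  {ae mu, forall H, carrier H g -> has_finite_index L (J H)}.
Proof.
have /pfcard_geP[G0|[e]] := G_countable.
  by have : [set: G] 1 by []; rewrite G0.
(* An enumeration of all finite sequences in [G]; codes that decode to nothing give the empty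
   one. *)
pose s_ k : seq G := [seq e m | m <- odflt [::] (unpickle k : option (seq nat))].
pose E n k := [set H : borelSub G | [/\ {in s_ k, forall a, L a},
  coset_independent (J H) (s_ k) & (n <= size (s_ k))%N]].
have s_surj (s : seq G) : exists k, s_ k = s.
  have [t ts] : exists t : seq nat, [seq e m | m <- t] = s.
    elim: s => [|a s [t <-]]; first by exists [::].
    by have [m _ <-] := @surj _ _ _ _ e a Logic.I; exists (m :: t).
  by exists (pickle t); rewrite /s_ pickleK.
pose A n := \bigcup_k E n k `&` [set H : borelSub G | carrier H g].
have [mA sumA] : (forall n, measurable (A n)) /\
    (forall n, \sum_(i < n) mu (A n) <= 1)%E.
  split=> n; have [mE sumE] := @measure_many_cosets n s_ (E n) (fun=> erefl) => //.
  by apply: measurableI => //; exact: measurable_carrier.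
have mN : measurable (\bigcap_n A n) by apply: bigcap_measurableType => n _.
(* The bad subgroups lie in every [A n], and [n] times the measure of [A n] is at most 1. *)
exists (\bigcap_n A n); split=> //.
  apply: probability_eq0_of_sums => // n.
  apply: le_trans (sumA n); apply: lee_sum => i _.
  by apply: le_measure; rewrite ?inE// => H; apply.
move=> H /= /not_implyP[Hg infJ] n _; split => //.
apply: contrapT => noE; apply: infJ; exists n => s sL sJ.
rewrite leqNgt; apply/negP => ns; apply: noE.
by have [k sk] := s_surj s; exists k => //; split; rewrite sk// ltnW.
Qed.

End FiniteIndex.

(** * Ergodicity and the trivial subgroup *)

Section Ergodic.
Context {R : realType} {G : groupType} (mu : probability (borelSub G) R).
Hypothesis G_countable : countable [set: G].
Hypothesis mu_ergodic : is_ergodic mu.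

Lemma carrier_trivial : carrier (trivial_subgroup G) = [set 1].
Proof. by apply/seteqP; split=> g => [/eqP//|->]; exact: carrier1. Qed.

(** The event [N] is invariant under conjugation, hence of measure 0 or 1. Measure 0 would
    concentrate [mu] on the trivial subgroup. *)
Lemma ae_nontrivial : ~ is_dirac_trivial mu ->
  {ae mu, forall H, exists2 g, carrier H g & g <> 1}.
Proof.
pose N := [set H : borelSub G | exists2 g, carrier H g & g <> 1].
move=> nodirac; have mN : measurable N.
  rewrite (_ : N = \bigcup_g [set H : borelSub G | g <> 1 /\ carrier H g]).
    apply: countable_bigcupT_measurable => // g.
    by apply: measurable_and; exact: measurable_carrier.
  by apply/seteqP; split=> H [g]; [move=> ? ?; exists g|move=> _ []; exists g].
have NC H : ~ N H -> H = trivial_subgroup G.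
  move=> nN; apply: carrier_inj; rewrite carrier_trivial; apply/seteqP; split=> g /=.
    by move=> Hg; apply: contrapT => g1; apply: nN; exists g.
  by move=> ->; exact: carrier1.
have [|mu0|mu1] := mu_ergodic mN.
- move=> g; apply/seteqP; split=> H [a].
    rewrite carrier_conj => Ha a1; exists (a ^ g^-1) => //.
    by move/eqP; rewrite conjg_eq1 => /eqP.
  move=> Ha a1; exists (a ^ g); first by rewrite carrier_conj conjgK.
  by move/eqP; rewrite conjg_eq1 => /eqP.
- exfalso; apply: nodirac => A mA; rewrite diracE.
  have [At|At] := pselect (A (trivial_subgroup G)).
    rewrite mem_set//; suff -> : mu A = 1%E by [].
    apply/eqP; rewrite eq_le probability_le1//=.
    have -> : (1 = mu (~` N))%E by rewrite probability_setC// mu0 sube0.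
    apply: le_measure; rewrite ?inE//; first exact: measurableC.
    by move=> H /NC ->.
  rewrite memNset//; suff -> : mu A = 0%E by [].
  apply/eqP; rewrite eq_le measure_ge0 andbT -mu0.
  apply: le_measure; rewrite ?inE// => H AH.
  by apply: contrapT => /NC HE; apply: At; rewrite -HE.
- exists (~` N); split => //; first exact: measurableC.
  by rewrite probability_setC// mu1 subee.
Qed.

End Ergodic.

Theorem theorem1p2 (R : realType) (G : groupType) (X : topologicalType)
    (act : X -> G -> X) (mu : probability (borelSub G) R)
    (G_countable : countable [set: G])
    (X_second_countable : @second_countable X)
    (X_hausdorff : hausdorff_space X)
    (act_homeo : action_by_homeomorphisms act)
    (act_faithful : faithful_action act)
    (mu_IRS : is_IRS mu)
    (mu_ergodic : is_ergodic mu) :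
  (~ is_dirac_trivial mu ->
     {ae mu, forall H : borelSub G,
       exists U : set X, [/\ open U, U !=set0 &
         derived (rigid_stabilizer act U) `<=` carrier H]})
  /\
  ((forall V : set X, open V ->
      forall x, V x -> ~ fixed_point act (rigid_stabilizer act V) x) ->
   {ae mu, forall H : borelSub G,
     forall x : X, ~ fixed_point act (carrier H) x ->
       exists U : set X, [/\ open U, U x &
         derived (rigid_stabilizer act U) `<=` carrier H]}).
Proof.
have [B B_countable B_basis] := X_second_countable.
have ae_full : {ae mu, forall H, virtually_full act B H}.
  apply: ae_countable => // W BW.
  have : {ae mu, forall H : borelSub G, forall g, [set: G] g -> carrier H g ->
      W `&` ((act^~ g) @` W) = set0 ->
      has_finite_index (rigid_stabilizer act W) (companioned act W g H)}.
    apply: ae_countable => // g _.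
    (* If [W] meets its translate, the condition holds vacuously. *)
    have [Wg|nWg] := pselect (W `&` ((act^~ g) @` W) = set0).
      apply: filterS (ae_companioned_finite_index G_countable act_homeo
        act_faithful Wg mu_IRS).
      by move=> H fin Hg _; exact: fin.
    by apply: aeW.
  by apply: filterS => H HW g; exact: HW g Logic.I.
have ae_filter := ae_filter_ringOfSetsType mu.
split=> [nodirac|nofix].
  move: ae_full (ae_nontrivial G_countable mu_ergodic nodirac).
  apply: filterS2 => H fullH [g Hg g1].
  exact: (derived_rigid_nonempty X_hausdorff act_homeo act_faithful B_basis
    fullH Hg g1).
apply: filterS ae_full => H fullH x.
exact: (derived_rigid_nbhs X_hausdorff act_homeo act_faithful B_basis nofix fullH).
Qed.
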